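(* Let $n \geq 3$ be an integer and let $H_n$ be the graph obtained from the wheel $W_n$ by deleting one spoke. Then $H_n$ is super edge-magic if and only if $n \leq 4$.
   Context: All graphs are finite and simple. For a graph $G$ with $p=|V(G)|$ vertices and $q=|E(G)|$ edges, a super edge-magic labeling is a bijection $f: V(G)\cup E(G)\to\{1,2,\ldots,p+q\}$ with $f(V(G))=\{1,\ldots,p\}$ such that $f(x)+f(xy)+f(y)$ is the same constant for every edge $xy$; $G$ is super edge-magic if it has such a labeling. The wheel $W_n = C_n + K_1$ has vertex set $\{c, x_1,\ldots,x_n\}$ and edges $cx_i$ ($1\le i\le n$, called spokes) and $x_ix_{i+1}$ ($1\le i\le n-1$) together with $x_nx_1$ (called rims). Thus $H_n$ has vertex set $\{c,x_1,\ldots,x_n\}$ and edge set $\{cx_i: 2\le i\le n\}\cup\{x_ix_{i+1}:1\le i\le n-1\}\cup\{x_nx_1\}$. *)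

(* Defs.v *)
From HB Require Import structures.
From mathcomp Require Import all_boot.

Set Implicit Arguments.
Unset Strict Implicit.
Unset Printing Implicit Defensive.

Record sgraph := SGraph {
  vertex :> finType;
  adj : rel vertex;
  adj_sym : symmetric adj;
  adj_irr : irreflexive adj
}.

Definition edges (G : sgraph) : {set {set G}} :=
  [set e | [exists x : G, exists y : G, adj x y && (e == [set x; y])]].

Definition edge (G : sgraph) : finType := {e : {set G} | e \in edges G}.

(* [inl] are the vertices and [inr] the edges of the disjoint union of V(G) and
   E(G); the fields [sem_inj] and [sem_image] say that f is a bijection of it
   onto {1, ..., p + q}. *)
Record super_edge_magic_labeling (G : sgraph) (f : G + edge G -> nat) : Prop :=
  SuperEdgeMagicLabeling {
    sem_inj : injective f;
    sem_image : forall k : nat,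
      (exists z, f z = k) <-> 1 <= k <= #|G| + #|edges G|;
    sem_vertices : forall k : nat,
      (exists x : G, f (inl x) = k) <-> 1 <= k <= #|G|;
    sem_magic : exists s : nat, forall (x y : G) (e : edge G),
      val e = [set x; y] -> f (inl x) + f (inr e) + f (inl y) = s
  }.

Definition super_edge_magic (G : sgraph) : Prop :=
  exists f : G + edge G -> nat, super_edge_magic_labeling f.

Section DeleteEdge.
Variables (G : sgraph) (u v : G).

Definition delete_edge_adj : rel G :=
  fun x y => adj x y && ([set x; y] != [set u; v]).

Lemma delete_edge_sym : symmetric delete_edge_adj.
Proof. by move=> x y; rewrite /delete_edge_adj adj_sym setUC. Qed.

Lemma delete_edge_irr : irreflexive delete_edge_adj.
Proof. by move=> x; rewrite /delete_edge_adj adj_irr. Qed.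

Definition delete_edge : sgraph := SGraph delete_edge_sym delete_edge_irr.

End DeleteEdge.

(* [None] is the hub c and [Some i] is x_(i+1); [ordS] is the cyclic successor,
   so it also gives the rim x_n x_1. The conjunct [i != j] only matters for
   n = 1, where it removes a loop. *)
Definition wheel_adj (n : nat) : rel (option 'I_n) := fun x y =>
  match x, y with
  | None, None => false
  | None, Some _ | Some _, None => true
  | Some i, Some j => (i != j) && ((j == ordS i) || (i == ordS j))
  end.

Lemma wheel_sym n : symmetric (@wheel_adj n).
Proof. by case=> [i|] [j|] //=; rewrite eq_sym orbC. Qed.

Lemma wheel_irr n : irreflexive (@wheel_adj n).
Proof. by case=> [i|] //=; rewrite eqxx. Qed.

Definition wheel (n : nat) : sgraph := SGraph (@wheel_sym n) (@wheel_irr n).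

Definition hub (n : nat) : wheel n := None.

Definition rim_vertex (n : nat) (i : 'I_n) : wheel n := Some i.

(* The deleted spoke is c x_1. *)
Definition wheel_minus_spoke (n : nat) (n_ge3 : 3 <= n) : sgraph :=
  delete_edge (hub n) (rim_vertex (Ordinal (ltnW (ltnW n_ge3)))).

(* Main.v *)
Require Import Defs.
From mathcomp Require Import all_boot zify.

(** Put [p = n + 1].  In a super edge-magic labeling the sums of the labels of
    adjacent vertices are pairwise distinct; [H_n] has [2 p - 3] edges, and sums
    of two distinct labels lie in [3 .. 2 p - 1], so every value of that interval
    is the sum of exactly one edge.  If the hub has label at least 5, the sums
    3, 4, 5 come from rims: the rims 12 and 13 are forced, and the sum 5 gives
    the rim 14, a third rim at 1, or the rim 23, a triangle of rims.  Replacing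
    each label [a] by [p + 1 - a], the hub label cannot be at most [p - 4] either,
    which leaves no hub label when [n >= 7].  For [n = 5] and [n = 6], adding up
    all the edge sums forces the hub and [x_1] to have the same label. *)

Set Implicit Arguments.
Unset Strict Implicit.
Unset Printing Implicit Defensive.

Lemma eq_set2 (T : finType) (x y u v : T) :
  ([set x; y] == [set u; v]) =
  ((x == u) && (y == v)) || ((x == v) && (y == u)).
Proof.
apply/eqP/orP => [e|[]/andP[/eqP-> /eqP->]//]; last by rewrite setUC.
have xe : x \in [set u; v] by rewrite -e set21.
have ye : y \in [set u; v] by rewrite -e set22.
have ue : u \in [set x; y] by rewrite e set21.
have ve : v \in [set x; y] by rewrite e set22.
move: xe ye ue ve; rewrite !inE ![u == _]eq_sym ![v == _]eq_sym.
by case: (x == u); case: (x == v); case: (y == u); case: (y == v) => //=; auto.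
Qed.

(** Pigeonhole, used both for the vertex labels and for the edge sums. *)
Lemma perm_iota_size (s : seq nat) m :
  uniq s -> (forall k, k \in s -> m <= k < m + size s) ->
  perm_eq s (iota m (size s)).
Proof.
move=> us bs; apply: uniq_perm => //; first exact: iota_uniq.
have sub : {subset s <= iota m (size s)} by move=> k /bs; rewrite mem_iota.
by have [] := uniq_min_size us sub; rewrite size_iota.
Qed.

(** * Edge sums of super edge-magic labelings *)

Section EdgeSums.

Variable G : sgraph.
Implicit Types (g : G -> nat) (x y : G).

(** What a super edge-magic labeling says about vertices alone: two edges with equal sums would
    carry equal edge labels. The conclusion compares sets because an edge can be read in either
    direction. *)
Record distinct_edge_sums g : Prop := DistinctEdgeSums {
  des_inj : injective g;
  des_bound : forall x, 1 <= g x <= #|G|;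
  des_sum : forall x y x' y', adj x y -> adj x' y' ->
    g x + g y = g x' + g y' -> [set x; y] = [set x'; y']
}.

Lemma adj_edge x y : adj x y -> exists e : edge G, val e = [set x; y].
Proof.
move=> xy; have xyE : [set x; y] \in edges G.
  by rewrite inE; apply/existsP; exists x; apply/existsP; exists y;
    rewrite xy eqxx.
by exists (exist (fun e => e \in edges G) _ xyE).
Qed.

Lemma edge_endpoints (e : edge G) : exists x y, adj x y /\ val e = [set x; y].
Proof.
have := valP e; rewrite inE => /existsP[x /existsP[y /andP[xy /eqP exy]]].
by exists x, y.
Qed.

Lemma super_edge_magic_sums :
  super_edge_magic G -> exists g, distinct_edge_sums g.
Proof.
case=> f [inj_f _ im_v [s magic]]; exists (fun x => f (inl x)); split.
- by move=> x y /inj_f[].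
- by move=> x; apply/im_v; exists x.
move=> x y x' y' /adj_edge[e exy] /adj_edge[e' exy'] eqs.
have h := magic x y e exy; have h' := magic x' y' e' exy'.
have /inj_f[E] : f (inr e) = f (inr e') by lia.
by rewrite -exy -exy' E.
Qed.

Lemma label_perm g : injective g -> (forall x, 1 <= g x <= #|G|) ->
  perm_eq [seq g x | x <- enum G] (iota 1 #|G|).
Proof.
move=> inj_g bg; have <- : size [seq g x | x <- enum G] = #|G|.
  by rewrite size_map cardE.
apply: perm_iota_size; first by rewrite map_inj_uniq ?enum_uniq.
by move=> k /mapP[x _ ->]; rewrite size_map -cardE add1n ltnS.
Qed.

Lemma label_surj g k : injective g -> (forall x, 1 <= g x <= #|G|) ->
  1 <= k <= #|G| -> exists x, g x = k.
Proof.
move=> inj_g bg; have /perm_mem/(_ k) := label_perm inj_g bg.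
rewrite mem_iota add1n ltnS => + bk.
by rewrite bk => /mapP[x _ ->]; exists x.
Qed.

(** Complementing the labels turns an edge sum [s] into [2 p + 2 - s], so sums stay distinct. This
    converts an upper bound on the hub label into a lower one. *)
Lemma des_dual g : distinct_edge_sums g ->
  distinct_edge_sums (fun x => #|G|.+1 - g x).
Proof.
case=> inj_g bg sg; split.
- by move=> x y e; apply: inj_g; have := bg x; have := bg y; lia.
- by move=> x; have := bg x; lia.
move=> x y x' y' xy xy' e; apply: sg => //.
by have := bg x; have := bg y; have := bg x'; have := bg y'; lia.
Qed.

(* The converse for graphs with [2 p - 3] edges: [u k] and [v k] are the ends of
   the unique edge of sum [k], which gets the label [3 p - k]. *)
Lemma edge_sums_super_edge_magic g (u v : nat -> G) :
  injective g -> (forall x, 1 <= g x <= #|G|) ->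
  (forall x y, adj x y -> [set x; y] = [set u (g x + g y); v (g x + g y)]) ->
  (forall k, 3 <= k < #|G|.*2 -> adj (u k) (v k) /\ g (u k) + g (v k) = k) ->
  super_edge_magic G.
Proof.
move=> inj_g bg sums edge_of.
(* Summing over the set [val e] avoids choosing an order of the ends of [e]. *)
pose w (e : edge G) := \sum_(x in val e) g x.
have wE x y e : val e = [set x; y] -> adj x y -> w e = g x + g y.
  move=> exy xy; rewrite /w exy big_setU1 ?big_set1 //= inE.
  by apply: contraTneq xy => ->; rewrite adj_irr.
have bw e : 3 <= w e < #|G|.*2.
  have [x [y [xy exy]]] := edge_endpoints e; rewrite (wE x y) //.
  have : g x <> g y by move/inj_g=> xx; rewrite xx adj_irr in xy.
  by have := bg x; have := bg y; lia.
have inj_w : injective w.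
  move=> e e'; have [x [y [xy exy]]] := edge_endpoints e.
  have [x' [y' [xy' exy']]] := edge_endpoints e'.
  rewrite (wE x y) // (wE x' y') // => E; apply: val_inj.
  by rewrite exy exy' (sums x y) // (sums x' y') // E.
have w_surj k : 3 <= k < #|G|.*2 -> exists e, w e = k.
  by case/edge_of=> xy <-; have [e exy] := adj_edge xy; exists e; apply: wE.
have card_e : #|edges G| = #|G|.*2 - 3.
  have <- : #|edge G| = #|edges G| by rewrite card_sig.
  rewrite cardE -(size_map w) -[RHS](size_iota 3); apply: perm_size.
  apply: uniq_perm; rewrite ?iota_uniq //.
    by rewrite map_inj_uniq //; apply: enum_uniq.
  move=> k.
  rewrite mem_iota; apply/mapP/idP => [[e _ ->]|bk]; first by have := bw e; lia.
  by have [|e <-] := w_surj k; [lia | exists e; rewrite ?mem_enum].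
have g_surj k : (exists x, g x = k) <-> 1 <= k <= #|G|.
  by split=> [[x <-]|]; [exact: bg | exact: label_surj].
(* As [w] runs through [3 .. 2 p - 1], the edge labels run through [p + 1 .. 3 p - 3], and
   [3 p - 3 = p + q]. *)
exists (fun z => match z with inl x => g x | inr e => 3 * #|G| - w e end).
split.
- case=> [x|e] [y|e'] E.
  + by rewrite (inj_g _ _ E).
  + by have := bg x; have := bw e'; lia.
  + by have := bg y; have := bw e; lia.
  + by congr inr; apply: inj_w; have := bw e; have := bw e'; lia.
- move=> k; rewrite card_e; split=> [[[x|e] <-]|bk].
  + by have := bg x; lia.
  + by have := bw e; lia.
  case: (leqP k #|G|) => kG.
    by have [|x <-] := (g_surj k).2; [lia | exists (inl x)].
  have [|e we] := w_surj (3 * #|G| - k); first by lia.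
  by exists (inr e); rewrite we; lia.
- by move=> k; rewrite -g_surj.
exists (3 * #|G|) => x y e exy; have := bw e.
have [x' [y' [xy' exy']]] := edge_endpoints e.
suff xy : adj x y by rewrite (wE x y) //; lia.
move/eqP: exy'; rewrite exy eq_set2 => /orP[]/andP[/eqP-> /eqP->] //.
by rewrite adj_sym.
Qed.

End EdgeSums.

(** * Adjacency and edges of [H_n] *)

Section WheelMinusSpoke.

Variables (n : nat) (n_ge3 : 3 <= n).

Local Notation H := (wheel_minus_spoke n_ge3).
Local Notation c := (None : H).
Local Notation x_ i := (Some i : H).
Local Notation o := (Ordinal (ltnW (ltnW n_ge3))).
Implicit Types (i j : 'I_n) (g : H -> nat).

Lemma card_wheel_minus_spoke : #|H| = n.+1.
Proof. by rewrite card_option card_ord. Qed.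

Lemma spoke_adj i : adj c (x_ i) = (i != o).
Proof. by rewrite /= /delete_edge_adj /= eq_set2 /= orbF. Qed.

Lemma spoke_adjC i : adj (x_ i) c = (i != o).
Proof. by rewrite adj_sym spoke_adj. Qed.

Lemma rim_adj i j :
  adj (x_ i) (x_ j) = (i != j) && ((j == ordS i) || (i == ordS j)).
Proof. by rewrite /= /delete_edge_adj /= eq_set2 /= andbF andbT. Qed.

Lemma hub_adj : adj c c = false.
Proof. by rewrite adj_irr. Qed.

Definition wheel_adjE := (spoke_adj, spoke_adjC, rim_adj, hub_adj).

Definition rim : rel 'I_n := fun i j => (j == ordS i) || (i == ordS j).

Lemma val_ordS i : val (ordS i) = if i.+1 == n then 0 else i.+1.
Proof.
rewrite /=; case: eqP => [->|ne]; first by rewrite modnn.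
by rewrite modn_small //; have := ltn_ord i; lia.
Qed.

Lemma ordS_neq i : i != ordS i.
Proof.
apply/eqP=> /(congr1 val); rewrite val_ordS /=; have := ltn_ord i.
by case: eqP; lia.
Qed.

(** A cycle of length at least 3 has no two rims with the same ends, so the [n] rims listed below
    are distinct as sets. *)
Lemma ordSS_neq i : i != ordS (ordS i).
Proof.
apply/eqP=> /(congr1 val); rewrite !val_ordS /=; have := ltn_ord i.
by do 2!case: eqP; lia.
Qed.

Lemma rim_degree i j k l : rim i j -> rim i k -> rim i l ->
  [|| j == k, j == l | k == l].
Proof.
have nbr m : rim i m -> m = ordS i \/ m = ord_pred i.
  by case/orP=> /eqP->; [left | right; rewrite ordSK].
by move=> /nbr[]-> /nbr[]-> /nbr[]->; rewrite eqxx ?orbT.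
Qed.

(** A triangle of rims would already be the whole cycle. *)
Lemma rim_triangle i j k : 3 < n -> i != j -> i != k -> j != k ->
  rim i j -> rim i k -> ~~ rim j k.
Proof.
move=> n_gt3; rewrite /rim -!val_eqE !val_ordS /=.
have := ltn_ord i; have := ltn_ord j; have := ltn_ord k.
by do 3!case: (@eqP _ _.+1 n); lia.
Qed.

(** Each edge occurs once, in a fixed direction, so that sums over edges become sums over ['I_n]. *)
Definition edge_list : seq (H * H) :=
  [seq (c, x_ i) | i <- enum 'I_n & i != o] ++
  [seq (x_ i, x_ (ordS i)) | i <- enum 'I_n].

Lemma mem_edge_list e : e \in edge_list ->
  (exists2 i, i != o & e = (c, x_ i)) \/ exists i, e = (x_ i, x_ (ordS i)).
Proof.
rewrite mem_cat => /orP[] /mapP[i]; last by right; exists i.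
by rewrite mem_filter => /andP[io _] ->; left; exists i.
Qed.

Lemma edge_list_adj e : e \in edge_list -> adj e.1 e.2.
Proof.
case/mem_edge_list=> [[i io ->]|[i ->]]; rewrite wheel_adjE //=.
by rewrite ordS_neq eqxx.
Qed.

Lemma edge_list_set_inj :
  {in edge_list &, injective (fun e : H * H => [set e.1; e.2])}.
Proof.
move=> e e' /mem_edge_list ee /mem_edge_list ee' /eqP; rewrite eq_set2.
case: ee ee' => [[i _ ->]|[i ->]] [[j _ ->]|[j ->]] //=.
- by rewrite orbF => /eqP->.
- by rewrite andbF.
(* Two rims that agree with opposite directions would give [ordS (ordS j) = j]. *)
case/orP=> [/andP[/eqP[->]]//|/andP[/eqP[->] /eqP[E]]].
by have := ordSS_neq j; rewrite E eqxx.
Qed.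

Lemma size_edge_list : size edge_list = n.-1 + n.
Proof.
rewrite size_cat !size_map size_filter -enumT size_enum_ord; congr (_ + _).
have := count_predC (pred1 o) (enum 'I_n).
rewrite count_uniq_mem ?enum_uniq // mem_enum /= size_enum_ord.
by move/(congr1 predn)=> <-.
Qed.

(** * Constraints on a labeling of [H_n] *)

Section Labeling.

Variable g : H -> nat.
Hypothesis g_des : distinct_edge_sums g.

Lemma label_bound x : 1 <= g x <= n.+1.
Proof. by rewrite -card_wheel_minus_spoke (des_bound g_des). Qed.

Lemma edge_list_sums :
  perm_eq [seq g e.1 + g e.2 | e <- edge_list] (iota 3 (n.-1 + n)).
Proof.
rewrite -size_edge_list -(size_map (fun e => g e.1 + g e.2)).
apply: perm_iota_size.
  rewrite map_inj_in_uniq.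
    rewrite cat_uniq; apply/and3P; split.
    - by rewrite map_inj_uniq => [|i j []//]; apply/filter_uniq/enum_uniq.
    - by apply/hasPn=> _ /mapP[i _ ->]; apply/mapP=> -[].
    - by rewrite map_inj_uniq => [|i j []//]; apply: enum_uniq.
  move=> e e' ee ee' /(des_sum g_des (edge_list_adj ee) (edge_list_adj ee')).
  exact: edge_list_set_inj.
move=> _ /mapP[[x y] /edge_list_adj xy ->]; rewrite size_map size_edge_list /=.
have : g x <> g y by move/(des_inj g_des)=> E; rewrite E adj_irr in xy.
by have := label_bound x; have := label_bound y; lia.
Qed.

Lemma label_sum : g c + \sum_i g (x_ i) = sumn (iota 1 n.+1).
Proof.
have /perm_sumn := label_perm (des_inj g_des) (des_bound g_des).
rewrite card_wheel_minus_spoke => <-; rewrite sumnE big_map.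
rewrite big_enum /= (bigD1 (c : H)) //=; congr (_ + _).
rewrite (reindex_omap (fun i => x_ i) id) /=; last by case.
by apply: eq_bigl => i; rewrite eqxx.
Qed.

(** Double counting: the hub lies on [n - 1] edges, each rim vertex on 3, except [x_1], which lies
    on 2; its missing term is moved to the right to avoid subtraction. *)
Lemma edge_sum :
  n.-1 * g c + 3 * \sum_i g (x_ i) = sumn (iota 3 (n.-1 + n)) + g (x_ o).
Proof.
rewrite -(perm_sumn edge_list_sums) sumnE big_map big_cat /= !big_map.
rewrite -enumT [X in _ = _ + X + _]big_enum big_filter.
rewrite [X in _ = X + _ + _]big_enum_cond /=.
rewrite !big_split /= sum_nat_const.
have <- : \sum_i g (x_ i) = \sum_i g (x_ (ordS i)).
  exact: (reindex_inj (@ordS_inj n)).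
rewrite (bigD1 o (F := fun i => g (x_ i)) (P := predT)) //=.
have -> : #|[pred i | i != o]| = n.-1.
  by have := cardC1 o; rewrite card_ord => <-; apply: eq_card.
by set S := \sum_(i | i != o) _; set a := g (Some o); lia.
Qed.

(** The sum of a spoke exceeds the hub label, so a sum not above that label comes from a rim. *)
Lemma small_sum_rim k : 3 <= k <= g c -> k <= n ->
  exists i, g (x_ i) + g (x_ (ordS i)) = k.
Proof.
move=> bk kn; have : k \in iota 3 (n.-1 + n) by rewrite mem_iota; lia.
rewrite -(perm_mem edge_list_sums) => /mapP[e /mem_edge_list ee kE].
case: ee kE => [[i _ ->]|[i ->]] /= kE; last by exists i.
move: bk (label_bound (x_ i)); rewrite kE.
by set a := g (Some i); set b := g None; lia.
Qed.

Lemma hub_label_lt5 : 5 <= n -> g c < 5.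
Proof.
move=> n_ge5; rewrite ltnNge; apply/negP=> c5.
pose w i := g (x_ i).
have bw i : 1 <= w i := (andP (label_bound (x_ i))).1.
have label k : 1 <= k <= 4 -> exists i, w i = k.
  move=> bk.
  have [|[i|] E] := label_surj (k := k) (des_inj g_des) (des_bound g_des).
  - by rewrite card_wheel_minus_spoke; lia.
  - by exists i.
  - by move: c5; rewrite E; lia.
have sum k : 3 <= k <= 5 -> exists i, w i + w (ordS i) = k.
  by move=> bk; apply: small_sum_rim; move: c5; set h := g c; lia.
have [//|u1 w1] := label 1; have [//|u2 w2] := label 2.
have [//|u3 w3] := label 3; have [//|u4 w4] := label 4.
have ne i j : w i <> w j -> i != j by move=> ?; apply/eqP=> E; subst.
have same i j : w i = w j -> i = j by move/(des_inj g_des)=> [].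
have dist i : w i <> w (ordS i).
  by move/same=> E; have := ordS_neq i; rewrite -E eqxx.
(* A rim having the same sum as the pair [j], [l] and one label in common with it joins [j] and
   [l]. *)
have rimI i j l : w i + w (ordS i) = w j + w l -> w i = w j \/ w i = w l ->
    rim j l.
  move=> E [e|e]; have e' := same _ _ e; subst i.
    by rewrite /rim (same l (ordS j)) ?eqxx //; lia.
  by rewrite /rim (same j (ordS l)) ?eqxx ?orbT //; lia.
have r12 : rim u1 u2.
  have [//|i E] := sum 3; have := bw i; have := bw (ordS i) => b b'.
  by apply: (rimI i); lia.
have r13 : rim u1 u3.
  have [//|i E] := sum 4; have := bw i; have := bw (ordS i) => b b'.
  (* [dist] excludes 4 = 2 + 2. *)
  by have d := dist i; apply: (rimI i); lia.
have [//|i E] := sum 5; have := bw i; have := bw (ordS i) => b b'.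
have [e|e] : (w i = 1 \/ w i = 4) \/ (w i = 2 \/ w i = 3) by lia.
  have r14 : rim u1 u4 by apply: (rimI i); lia.
  have := rim_degree r12 r13 r14.
  by rewrite !(negPf (ne _ _ _)) ?w2 ?w3 ?w4.
have r23 : rim u2 u3 by apply: (rimI i); lia.
have u12 : u1 != u2 by apply: ne; rewrite w1 w2.
have u13 : u1 != u3 by apply: ne; rewrite w1 w3.
have u23 : u2 != u3 by apply: ne; rewrite w2 w3.
by have := rim_triangle (ltnW n_ge5) u12 u13 u23 r12 r13; rewrite r23.
Qed.

End Labeling.

Lemma wheel_minus_spoke_sums_le4 g : distinct_edge_sums g -> n <= 4.
Proof.
move=> g_des; rewrite leqNgt; apply/negP=> n_ge5.
have lo := hub_label_lt5 g_des n_ge5.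
(* The complementary labeling gives [n + 2 - g c < 5]; with [g c < 5] this leaves only [n <= 6]. *)
have := hub_label_lt5 (des_dual g_des) n_ge5.
rewrite card_wheel_minus_spoke => hi; have bc := label_bound g_des c.
have ne : g c <> g (x_ o) by move/(des_inj g_des).
move: lo hi bc ne (label_sum g_des) (edge_sum g_des).
move: (g c) (g (x_ o)) (\sum_i _) => a b S lo hi bc ne.
(* Eliminating [S] from the two sums gives [a = b] for [n = 5] and [2 a = b + 4] for [n = 6]; in the
   latter case the bounds force [a = 4], hence [b = 4]. *)
have [n5|n6] : n = 5 \/ n = 6 by lia.
  by rewrite n5 /=; lia.
by rewrite n6 /=; lia.
Qed.

End WheelMinusSpoke.

(** * Explicit labelings for [n = 3] and [n = 4] *)

Local Arguments adj : simpl never.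

Lemma wheel3_minus_spoke (h : 3 <= 3) : super_edge_magic (wheel_minus_spoke h).
Proof.
pose x i (lt_i3 : i < 3) : wheel_minus_spoke h := Some (Ordinal lt_i3).
pose g (z : wheel_minus_spoke h) :=
  if z is Some i then nth 0 [:: 4; 2; 3] i else 1.
(* The lists start at the least sum 3: the edges of sums 3 to 7 are [c x_2], [c x_3], [x_2 x_3],
   [x_1 x_2], [x_1 x_3]. The entry [None] is the hub. *)
pose u k := nth None [:: None; None; x 1 isT; x 0 isT; x 0 isT] (k - 3).
pose v k := nth None [:: x 1 isT; x 2 isT; x 2 isT; x 1 isT; x 2 isT] (k - 3).
apply: (@edge_sums_super_edge_magic _ g u v).
- by case=> [[[|[|[|?]]] ?]|] [[[|[|[|?]]] ?]|] //= _; congr Some; apply: val_inj.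
- by rewrite card_wheel_minus_spoke; case=> [[[|[|[|?]]] ?]|].
- move=> y z yz; apply/eqP; rewrite eq_set2; move: yz.
  by case: y => [[[|[|[|?]]] ?]|]; case: z => [[[|[|[|?]]] ?]|];
    rewrite wheel_adjE.
rewrite card_wheel_minus_spoke.
by case=> [|[|[|[|[|[|[|[|k]]]]]]]] // _; rewrite /u /v /= !wheel_adjE.
Qed.

Lemma wheel4_minus_spoke (h : 3 <= 4) : super_edge_magic (wheel_minus_spoke h).
Proof.
pose x i (lt_i4 : i < 4) : wheel_minus_spoke h := Some (Ordinal lt_i4).
pose g (z : wheel_minus_spoke h) :=
  if z is Some i then nth 0 [:: 3; 1; 4; 5] i else 2.
(* The edges of sums 3 to 9 are [c x_2], [x_1 x_2], [x_2 x_3], [c x_3], [c x_4], [x_1 x_4],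
   [x_3 x_4]. *)
pose u k := nth None
  [:: None; x 0 isT; x 1 isT; None; None; x 0 isT; x 2 isT] (k - 3).
pose v k := nth None
  [:: x 1 isT; x 1 isT; x 2 isT; x 2 isT; x 3 isT; x 3 isT; x 3 isT] (k - 3).
apply: (@edge_sums_super_edge_magic _ g u v).
- by case=> [[[|[|[|[|?]]]] ?]|] [[[|[|[|[|?]]]] ?]|] //= _;
    congr Some; apply: val_inj.
- by rewrite card_wheel_minus_spoke; case=> [[[|[|[|[|?]]]] ?]|].
- move=> y z yz; apply/eqP; rewrite eq_set2; move: yz.
  by case: y => [[[|[|[|[|?]]]] ?]|]; case: z => [[[|[|[|[|?]]]] ?]|];
    rewrite wheel_adjE.
rewrite card_wheel_minus_spoke.
by case=> [|[|[|[|[|[|[|[|[|[|k]]]]]]]]]] // _; rewrite /u /v /= !wheel_adjE.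
Qed.

Theorem theorem1 (n : nat) (n_ge3 : 3 <= n) :
  super_edge_magic (wheel_minus_spoke n_ge3) <-> n <= 4.
Proof.
split=> [/super_edge_magic_sums[g]|]; first exact: wheel_minus_spoke_sums_le4.
case: n n_ge3 => [|[|[|[|[|n]]]]] // h _.
- exact: wheel3_minus_spoke.
- exact: wheel4_minus_spoke.
Qed.
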